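(* Let $\Gamma_n=\{P_1,\ldots,P_k\}$ with $k\ge3$, let $Q$ be a witness of $\Gamma_n$, and let $v_0,v_1,\ldots,v_r$ be a special path in $G_n(Q)$ of minimal length among all special paths in $G_n(Q)$; after reindexing, $v_0\cong P_1$, $v_1,\ldots,v_{r-1}\cong P_2$, $v_r\cong P_3$. Write $A=v_0$, $C=v_r$ (the anchor copies). Suppose the path contains at least two copies of $P_2$ (i.e. $r\ge 3$). Then (1) $\bigcup_{j=0}^r v_j=A\cup C$, and (2) the number of copies of $P_2$ on the path, $r-1$, equals $|A\setminus(A\cap C)|-1=|C\setminus(A\cap C)|-1$.
   Context: $\Gamma_n$ is a set of $k$ pairwise non-isomorphic posets of size $n$; $Q$ is a witness if the set of isomorphism classes of downsets of $Q$ of size $n$ is exactly $\Gamma_n$. The exchange graph $G_n(Q)$ has as vertices all downsets of $Q$ of size $n$ (as subsets), with an edge between two such downsets when they differ by exactly one element. A special path is a path $v_0,v_1,\ldots,v_r$ in $G_n(Q)$ with $r\ge 2$ such that for some three distinct indices $a,b,c$, $v_0\cong P_a$, $v_1,\ldots,v_{r-1}\cong P_b$, and $v_r\cong P_c$. *)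

(* Defs.v *)
From mathcomp Require Import all_boot.
Set Implicit Arguments. Unset Strict Implicit. Unset Printing Implicit Defensive.

Definition is_poset (T : finType) (le : rel T) : Prop :=
  [/\ reflexive le, antisymmetric le & transitive le].

(* An abstract poset of size n is represented on the carrier 'I_n. *)
Definition poset_iso (n : nat) (R1 R2 : rel 'I_n) : Prop :=
  exists s : 'I_n -> 'I_n, bijective s /\ forall x y, R1 x y = R2 (s x) (s y).

Definition downset (T : finType) (le : rel T) (D : {set T}) : Prop :=
  forall x y, le x y -> y \in D -> x \in D.

Definition sub_iso (T : finType) (le : rel T) (D : {set T}) (n : nat)
    (R : rel 'I_n) : Prop :=
  exists f : 'I_n -> T,
    [/\ injective f, D = [set f i | i in 'I_n] &
        forall i j, R i j = le (f i) (f j)].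

Definition Gvertex (T : finType) (le : rel T) (n : nat) (D : {set T}) : Prop :=
  downset le D /\ #|D| = n.

Definition Gadj (T : finType) (D1 D2 : {set T}) : Prop :=
  #|D1 :\: D2| = 1 /\ #|D2 :\: D1| = 1.

(* Gamma_n = {P_0, ..., P_(k-1)}: k pairwise non-isomorphic posets of size n. *)
Definition Gamma_family (n k : nat) (P : 'I_k -> rel 'I_n) : Prop :=
  (forall i, is_poset (P i)) /\
  (forall i j, i != j -> ~ poset_iso (P i) (P j)).

Definition witness (T : finType) (le : rel T) (n k : nat)
    (P : 'I_k -> rel 'I_n) : Prop :=
  is_poset le /\
  (forall D, Gvertex le n D -> exists i, sub_iso le D (P i)) /\
  (forall i, exists D, Gvertex le n D /\ sub_iso le D (P i)).

Definition Gpath (T : finType) (le : rel T) (n : nat)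
    (v : nat -> {set T}) (r : nat) : Prop :=
  [/\ forall j, j <= r -> Gvertex le n (v j),
      forall j, j < r -> Gadj (v j) (v j.+1) &
      forall i j, i <= r -> j <= r -> v i = v j -> i = j].

Definition special_path (T : finType) (le : rel T) (n k : nat)
    (P : 'I_k -> rel 'I_n) (v : nat -> {set T}) (r : nat) : Prop :=
  Gpath le n v r /\ 2 <= r /\
  exists a b c : 'I_k,
    [/\ [/\ a != b, b != c & a != c],
        sub_iso le (v 0) (P a),
        (forall j, 0 < j < r -> sub_iso le (v j) (P b)) &
        sub_iso le (v r) (P c)].

(* Main.v *)
(* In a shortest special path no element enters and later leaves, or leaves
   and later re-enters.  Otherwise take such an element z whose two events,
   at steps i < m, are as close as possible.  If z enters at i and leaves at m,
   then z is maximal in every v t with i < t <= m + 1, so the sets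
   (v t :|: v t.+1) :\ z are downsets; they form a walk from v i to v (m + 1)
   one step shorter than the path.  Each of them is a common neighbour of v t
   and v (t + 1), and minimality forces it to be a copy of P_2, so the shorter
   walk is special: a contradiction.  The other case is the same argument for
   the complements, which are the downsets of the dual order.  Hence every
   element changes membership at most once along the path: each of the r steps
   removes a new element of A for good, and nothing outside A :|: C appears. *)

Require Import Defs.
From mathcomp Require Import all_boot zify.
Set Implicit Arguments. Unset Strict Implicit. Unset Printing Implicit Defensive.

Section Exchange.
Variable T : finType.
Implicit Types (A B D : {set T}) (v : nat -> {set T}).

Lemma Gadj_sym A B : Gadj A B -> Gadj B A.
Proof. by case. Qed.

Lemma GadjC A B : Gadj A B -> Gadj (~: A) (~: B).
Proof.
have CD X Y : ~: X :\: ~: Y = Y :\: X.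
  by apply/setP=> u; rewrite !inE negbK andbC.
by case; split; rewrite CD.
Qed.

Lemma Gadj_setD1 A B : Gadj A B -> exists x, A :\: B = [set x].
Proof. by case=> /eqP/cards1P. Qed.

Lemma Gadj_setD_uniq A B x y :
  Gadj A B -> x \in A :\: B -> y \in A :\: B -> x = y.
Proof. by case/Gadj_setD1=> w ->; rewrite !inE => /eqP-> /eqP->. Qed.

Lemma Gadj_setD_sub1 A B x :
  #|A| = #|B| -> A :\: B \subset [set x] -> A != B -> Gadj A B.
Proof.
move=> eqAB subx neqAB.
have le1 : #|A :\: B| <= 1 by rewrite -(cards1 x); exact: subset_leq_card.
have ne0 : #|A :\: B| != 0.
  rewrite cards_eq0 setD_eq0; apply: contra neqAB => sAB.
  by rewrite eqEcard sAB eqAB leqnn.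
have cardBA : #|B :\: A| = #|A :\: B| by rewrite !cardsD eqAB setIC.
by split; rewrite ?cardBA; lia.
Qed.

Lemma Gadj_cardU A B : Gadj A B -> #|A :|: B| = #|A|.+1.
Proof.
case=> _; rewrite cardsD setIC => cardBA.
have := cardsUI A B; have := subset_leq_card (subsetIr A B); lia.
Qed.

Lemma Gvertex_setC (le : rel T) n D :
  n <= #|T| -> Gvertex (fun x y => le y x) (#|T| - n) (~: D) <-> Gvertex le n D.
Proof.
move=> leqnT; rewrite /Gvertex cardsCs setCK; split=> -[downD cardD]; split.
- move=> x y lexy yD; apply/negPn/negP=> xD.
  by have := downD y x lexy; rewrite !inE => /(_ xD); rewrite yD.
- by have := max_card D; lia.
- by move=> x y leyx; rewrite !inE; apply: contra => xD; apply: downD leyx xD.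
- by rewrite cardD.
Qed.

Definition enters v t u := (u \notin v t) && (u \in v t.+1).
Definition leaves v t u := (u \in v t) && (u \notin v t.+1).
Definition cancelling v p q u :=
  enters v p u && leaves v q u || leaves v p u && enters v q u.

Lemma enters_setC v t u : enters (fun s => ~: v s) t u = leaves v t u.
Proof. by rewrite /enters /leaves !inE negbK. Qed.

Lemma leaves_setC v t u : leaves (fun s => ~: v s) t u = enters v t u.
Proof. by rewrite /enters /leaves !inE negbK. Qed.

Lemma cancelling_setC v p q u :
  cancelling (fun s => ~: v s) p q u = cancelling v p q u.
Proof. by rewrite /cancelling !enters_setC !leaves_setC orbC. Qed.

Lemma leaves_between v a b u :
  a <= b -> u \in v a -> u \notin v b -> exists2 p, a <= p < b & leaves v p u.
Proof.
elim: b => [|b IHb] leab uva uvb.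
  by move: leab uva; rewrite leqn0 => /eqP->; rewrite (negbTE uvb).
case: (ltngtP a b.+1) leab => // [ltab _ | eab _]; last first.
  by move: uva; rewrite eab (negbTE uvb).
case uvb' : (u \in v b); first by exists b; rewrite ?ltab /leaves ?uvb' //; lia.
have [p /andP[lep ltp] lvp] := IHb ltab uva (negbT uvb').
by exists p; rewrite ?lep //; lia.
Qed.

Lemma enters_between v a b u :
  a <= b -> u \notin v a -> u \in v b -> exists2 p, a <= p < b & enters v p u.
Proof.
move=> leab uva uvb.
have [||p rangep] := @leaves_between (fun s => ~: v s) a b u leab.
- by rewrite inE.
- by rewrite inE negbK.
- by rewrite leaves_setC; exists p.
Qed.

Lemma leaves_uniq v t x y :
  Gadj (v t) (v t.+1) -> leaves v t x -> leaves v t y -> x = y.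
Proof.
have inD w : leaves v t w -> w \in v t :\: v t.+1 by rewrite inE andbC.
by move=> adj /inD xD /inD yD; apply: Gadj_setD_uniq adj xD yD.
Qed.

Lemma enters_uniq v t x y :
  Gadj (v t) (v t.+1) -> enters v t x -> enters v t y -> x = y.
Proof.
have inD w : enters v t w -> w \in v t.+1 :\: v t by rewrite inE.
by move=> /Gadj_sym adj /inD xD /inD yD; apply: Gadj_setD_uniq adj xD yD.
Qed.

Lemma Gadj_leaves v t : Gadj (v t) (v t.+1) -> exists x, leaves v t x.
Proof.
case/Gadj_setD1=> x dx; exists x.
have : x \in v t :\: v t.+1 by rewrite dx set11.
by rewrite inE andbC.
Qed.

End Exchange.

(* Replacing v (i+1), ..., v m by W (i+1), ..., W m = v (m+1) shortens the
   walk by one step; the last conjunct is what makes each W t a copy of P_2. *)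
Definition bypass (T : finType) (le : rel T) n (v W : nat -> {set T}) i m :=
  [/\ W m = v m.+1,
      forall t, i < t <= m -> Gvertex le n (W t),
      Gadj (v i) (W i.+1),
      forall t, i < t < m -> Gadj (W t) (W t.+1) &
      forall t, i < t < m -> Gadj (v t) (W t) /\ Gadj (W t) (v t.+1)].

Section Detour.
Variables (T : finType) (le : rel T) (n : nat) (v : nat -> {set T}).
Variables (i m : nat) (z : T).
Hypothesis vV : forall t, t <= m.+1 -> Gvertex le n (v t).
Hypothesis vA : forall t, t <= m -> Gadj (v t) (v t.+1).
Hypothesis lt_im : i < m.
Hypothesis z_enters : enters v i z.
Hypothesis z_leaves : leaves v m z.
Hypothesis clean_inside : forall p q u,
  i <= p -> p < q <= m -> q - p < m - i -> ~~ cancelling v p q u.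
Hypothesis v_i_neq_v_i2 : v i != v i.+2.

Definition detour t := (v t :|: v t.+1) :\ z.

Lemma z_in_between t : i < t <= m -> z \in v t.
Proof.
case/andP=> ltit letm; apply/negPn/negP=> zt.
have [_ zi1] := andP z_enters.
have [p /andP[lep ltpt] zp] := leaves_between ltit zi1 zt.
have /negP[] : ~~ cancelling v i p z by apply: clean_inside; lia.
by rewrite /cancelling z_enters zp.
Qed.

(* An element above z would have to enter after step i and leave before
   step m, a closer cancelling pair. *)
Lemma z_maximal t u : i < t <= m.+1 -> u \in v t -> le z u -> u = z.
Proof.
case/andP=> ltit letm ut lezu; case: (eqVneq u z) => // neq_uz; exfalso.
have [zi _] := andP z_enters; have [_ zm1] := andP z_leaves.
have down s : s <= m.+1 -> u \in v s -> z \in v s.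
  by move=> les; apply: (vV les).1.
have ui : u \notin v i by apply: contra zi; apply: down; lia.
have um1 : u \notin v m.+1 by apply: contra zm1; apply: down.
have [p /andP[lep ltpt] up] := enters_between (ltnW ltit) ui ut.
have [q /andP[letq ltqm1] uq] := leaves_between letm ut um1.
have ltip : i < p.
  rewrite ltn_neqAle lep andbT; apply: contraNneq neq_uz => eip; apply/eqP.
  by apply: enters_uniq (vA (ltnW lt_im)) _ z_enters; rewrite eip.
have ltqm : q < m.
  rewrite ltn_neqAle -ltnS ltqm1 andbT; apply: contraNneq neq_uz => eqm.
  by apply/eqP; apply: leaves_uniq (vA (leqnn m)) _ z_leaves; rewrite -eqm.
have /negP[] : ~~ cancelling v p q u.
  by apply: clean_inside; clear -ltip ltpt letq ltqm; lia.
by rewrite /cancelling up uq.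
Qed.

Lemma leaves_stays_out t x :
  i <= t < m -> 1 < m - i -> leaves v t x -> x \notin v t.+2.
Proof.
move=> /andP[leit ltm] gap lx; apply/negP=> xt2.
have [_ xt1] := andP lx.
have /negP[] : ~~ cancelling v t t.+1 x by apply: clean_inside; lia.
by rewrite /cancelling lx /enters xt1 xt2 orbT.
Qed.

Lemma detour_last : detour m = v m.+1.
Proof.
apply/setP=> u; rewrite !inE; case: (eqVneq u z) => [->|neq_uz] /=.
  by have [_ /negbTE->] := andP z_leaves.
case um1 : (u \in v m.+1); rewrite ?orbT // orbF; apply/negP=> um.
move/eqP: neq_uz; apply.
by apply: leaves_uniq (vA (leqnn m)) _ z_leaves; rewrite /leaves um um1.
Qed.

Lemma detour_vertex t : i < t <= m -> Gvertex le n (detour t).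
Proof.
case/andP=> ltit letm; have [downt cardt] := vV (leqW letm).
have [downt1 _] : Gvertex le n (v t.+1) by apply: vV.
split.
  move=> x y lexy; rewrite !inE => /andP[neq_yz yt].
  have xt : (x \in v t) || (x \in v t.+1).
    by case/orP: yt => yt; [rewrite (downt x y) | rewrite (downt1 x y) ?orbT].
  rewrite xt andbT; apply: contraNneq neq_yz => exz; apply/eqP.
  by move: lexy; rewrite exz; case/orP: yt => yt; apply: z_maximal yt; lia.
have := cardsD1 z (v t :|: v t.+1).
rewrite inE z_in_between ?ltit // (Gadj_cardU (vA letm)) cardt.
by rewrite /detour; lia.
Qed.

Lemma card_detour t : i < t <= m -> #|detour t| = n.
Proof. by case/detour_vertex. Qed.

Lemma card_v t : t <= m.+1 -> #|v t| = n.
Proof. by case/vV. Qed.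

Lemma v_detour_first_adj : Gadj (v i) (detour i.+1).
Proof.
have [x lx] := Gadj_leaves (vA (ltnW lt_im)); have [xi xi1] := andP lx.
apply: (@Gadj_setD_sub1 _ _ _ x).
- by rewrite card_v ?card_detour //; lia.
- apply/subsetP=> u; rewrite /detour !inE negb_and negbK negb_or.
  case/andP=> /orP[/eqP-> | /andP[ui1 _]] ui.
    by have [/negP] := andP z_enters.
  by apply/eqP; apply: leaves_uniq (vA (ltnW lt_im)) _ lx; rewrite /leaves ui ui1.
- case: (ltngtP m i.+1) lt_im => // [ltim _ | eim _]; last first.
    by rewrite -eim detour_last eim.
  apply/negP=> /eqP vi_eq; have: x \in detour i.+1 by rewrite -vi_eq.
  rewrite /detour !inE (negbTE xi1) /= => /andP[_].
  by apply/negP; apply: leaves_stays_out lx; lia.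
Qed.

Lemma detour_adj t : i < t < m -> Gadj (detour t) (detour t.+1).
Proof.
case/andP=> ltit ltm; have [x lx] := Gadj_leaves (vA (ltnW ltm)).
have [xt xt1] := andP lx.
apply: (@Gadj_setD_sub1 _ _ _ x).
- by rewrite !card_detour //; lia.
- apply/subsetP=> u; rewrite /detour !inE negb_and negbK negb_or.
  case/andP=> /orP[/eqP-> | /andP[ut1 _]] /andP[/negbTE neq_uz ut].
    by rewrite eqxx in neq_uz.
  rewrite (negbTE ut1) orbF in ut.
  by apply/eqP; apply: leaves_uniq (vA (ltnW ltm)) _ lx; rewrite /leaves ut ut1.
- apply/negP=> /eqP eq_detour.
  have : x \in detour t.
    rewrite /detour !inE xt andbT; apply: contraNneq xt1 => ->.
    by apply: z_in_between; lia.
  rewrite eq_detour /detour !inE (negbTE xt1) /= => /andP[_].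
  by apply/negP; apply: leaves_stays_out lx; lia.
Qed.

Lemma v_detour_adj t : i < t <= m -> Gadj (v t) (detour t).
Proof.
move=> ranget; apply: (@Gadj_setD_sub1 _ _ _ z).
- by rewrite card_v ?card_detour //; lia.
- apply/subsetP=> u; rewrite /detour !inE negb_and negbK.
  by case/andP=> /orP[/eqP-> // | /norP[/negP ut _] /ut []].
- apply/negP=> /eqP eq_detour; have := z_in_between ranget.
  by rewrite eq_detour !inE eqxx.
Qed.

Lemma detour_v_adj t : i < t < m -> Gadj (detour t) (v t.+1).
Proof.
case/andP=> ltit ltm; have [x lx] := Gadj_leaves (vA (ltnW ltm)).
apply: (@Gadj_setD_sub1 _ _ _ x).
- by rewrite card_v ?card_detour //; lia.
- apply/subsetP=> u; rewrite /detour !inE => /andP[ut1 /andP[_ /orP[ut | ut1']]].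
    by apply/eqP; apply: leaves_uniq (vA (ltnW ltm)) _ lx; rewrite /leaves ut ut1.
  by rewrite ut1' in ut1.
- apply/negP=> /eqP eq_detour; have : z \in v t.+1 by apply: z_in_between; lia.
  by rewrite -eq_detour !inE eqxx.
Qed.

Lemma detour_bypass : bypass le n v detour i m.
Proof.
split.
- exact: detour_last.
- exact: detour_vertex.
- exact: v_detour_first_adj.
- exact: detour_adj.
- move=> t /andP[ltit ltm]; split; first by apply: v_detour_adj; lia.
  by apply: detour_v_adj; lia.
Qed.

End Detour.

Lemma bypass_setC (T : finType) (le : rel T) n (v W : nat -> {set T}) i m :
  n <= #|T| -> bypass (fun x y => le y x) (#|T| - n) (fun t => ~: v t) W i m ->
  bypass le n v (fun t => ~: W t) i m.
Proof.
move=> leqnT [Wm WV Wi WW Wvw]; split.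
- by rewrite Wm setCK.
- by move=> t /WV WVt; apply/(Gvertex_setC _ _ leqnT); rewrite setCK.
- by have := GadjC Wi; rewrite setCK.
- by move=> t /WW/GadjC.
- move=> t /Wvw[/GadjC vW /GadjC Wv].
  by rewrite setCK in vW; rewrite setCK in Wv; split.
Qed.

(* The complement of a downset is a downset of the dual order, and
   complementing exchanges entering and leaving. *)
Lemma cancelling_bypass (T : finType) (le : rel T) n (v : nat -> {set T}) i m u :
  n <= #|T| ->
  (forall t, t <= m.+1 -> Gvertex le n (v t)) ->
  (forall t, t <= m -> Gadj (v t) (v t.+1)) ->
  i < m -> cancelling v i m u ->
  (forall p q u, i <= p -> p < q <= m -> q - p < m - i -> ~~ cancelling v p q u) ->
  v i != v i.+2 ->
  exists W, bypass le n v W i m.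
Proof.
move=> leqnT vV vA lt_im /orP[/andP[ui um] | /andP[ui um]] clean v_i_neq_v_i2.
  by exists (detour v u); apply: detour_bypass.
exists (fun t => ~: detour (fun s => ~: v s) u t); apply: bypass_setC => //.
apply: detour_bypass; rewrite ?enters_setC ?leaves_setC //.
- by move=> t /vV /(Gvertex_setC _ _ leqnT).
- by move=> t /vA/GadjC.
- by move=> p q w ? ? ?; rewrite cancelling_setC; apply: clean.
- by apply: contra_neq v_i_neq_v_i2 => /setC_inj.
Qed.

Lemma sub_iso_poset_iso (T : finType) (le : rel T) n (D : {set T})
    (R1 R2 : rel 'I_n) :
  sub_iso le D R1 -> sub_iso le D R2 -> poset_iso R1 R2.
Proof.
case=> f1 [f1_inj D1 R1f1] [f2 [f2_inj D2 R2f2]].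
have f2_onto i : exists j, f2 j = f1 i.
  have : f1 i \in D by rewrite D1 imset_f.
  by rewrite D2 => /imsetP[j _ ->]; exists j.
pose s i := odflt i [pick j | f2 j == f1 i].
have f2s i : f2 (s i) = f1 i.
  rewrite /s; case: pickP => [j /eqP // | none].
  by have [j ej] := f2_onto i; have := none j; rewrite ej eqxx.
exists s; split.
  by apply: injF_bij => x y sxy; apply: f1_inj; rewrite -!f2s sxy.
by move=> x y; rewrite R1f1 R2f2 !f2s.
Qed.

Lemma Gamma_sub_iso_eq (T : finType) (le : rel T) n k (P : 'I_k -> rel 'I_n)
    (D : {set T}) x y :
  Gamma_family P -> sub_iso le D (P x) -> sub_iso le D (P y) -> x = y.
Proof.
case=> _ noniso Dx Dy; apply/eqP/negPn/negP => neq_xy.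
exact: noniso neq_xy (sub_iso_poset_iso Dx Dy).
Qed.

Definition special_walk (T : finType) (le : rel T) n k (P : 'I_k -> rel 'I_n)
    (w : nat -> {set T}) (L : nat) : Prop :=
  [/\ forall j, j <= L -> Gvertex le n (w j),
      forall j, j < L -> Gadj (w j) (w j.+1),
      2 <= L &
      exists a b c : 'I_k,
        [/\ [/\ a != b, b != c & a != c],
            sub_iso le (w 0) (P a),
            (forall j, 0 < j < L -> sub_iso le (w j) (P b)) &
            sub_iso le (w L) (P c)]].

(* A repeated vertex can only be an inner copy of P_2, so the loop between its
   two occurrences can be cut out. *)
Lemma special_walk_path (T : finType) (le : rel T) n k (P : 'I_k -> rel 'I_n)
    (w : nat -> {set T}) L :
  Gamma_family P -> special_walk le P w L ->
  exists2 L', L' <= L & exists w', special_path le P w' L'.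
Proof.
move=> HG; elim/ltn_ind: L w => L IHL w [wV wA leL2 [a [b [c [abc wa wb wc]]]]].
have [neq_ab neq_bc neq_ac] := abc.
have eq_type D x y := @Gamma_sub_iso_eq _ le _ _ P D x y HG.
case: (boolP [exists p : 'I_L.+1, exists q : 'I_L.+1, (p < q) && (w p == w q)]);
    last first.
  move/existsPn=> distinct; exists L => //; exists w; split; last first.
    by split=> //; exists a, b, c.
  split=> // i j leiL lejL wij.
  have key (p q : 'I_L.+1) : p < q -> w p != w q.
    by move=> ltpq; have /existsPn/(_ q) := distinct p; rewrite ltpq.
  have key' i' j' (lei' : i' <= L) (lej' : j' <= L) : i' < j' -> w i' != w j'.
    exact: (key (Ordinal (lei' : i' < L.+1)) (Ordinal (lej' : j' < L.+1))).
  case: (ltngtP i j) => // [ltij | ltji].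
    by move: (key' i j leiL lejL ltij); rewrite wij eqxx.
  by move: (key' j i lejL leiL ltji); rewrite wij eqxx.
case/existsP=> p /existsP[q /andP[ltpq /eqP wpq]].
have leqL : q <= L by rewrite -ltnS ltn_ord.
have gt0p : 0 < p.
  rewrite lt0n; apply/eqP=> p0; rewrite p0 in wpq.
  case: (ltngtP q L) leqL => // [ltqL | eqL] _.
    by move/eqP: neq_ab; apply; apply: eq_type wa _; rewrite wpq; apply: wb; lia.
  by move/eqP: neq_ac; apply; apply: eq_type wa _; rewrite wpq eqL.
have ltqL : q < L.
  rewrite ltn_neqAle leqL andbT; apply/eqP=> eqL.
  by move/eqP: neq_bc; apply; apply: eq_type wc; rewrite -eqL -wpq; apply: wb; lia.
pose w' s := if s <= p then w s else w (s + (q - p)).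
have [L' leL' path'] :
    exists2 L', L' <= L - (q - p) & exists w'', special_path le P w'' L'.
  apply: (IHL _ _ w'); first by lia.
  split.
  - by move=> j lej; rewrite /w'; case: ifP => _; apply: wV; lia.
  - move=> j ltj; rewrite /w'; case: (ltngtP j p) => [ltjp | ltpj | ->].
    + by apply: wA; lia.
    + by rewrite addSn; apply: wA; lia.
    + by rewrite addSn subnKC ?(ltnW ltpq) // wpq; apply: wA; lia.
  - by lia.
  - exists a, b, c; split=> //.
    + by move=> j rangej; rewrite /w'; case: ifP => _; apply: wb; lia.
    + by rewrite /w' ifN ?subnK ?wc //; lia.
by exists L' => //; lia.
Qed.

Section MinimalSpecialPath.
Variables (n k : nat) (P : 'I_k -> rel 'I_n) (T : finType) (le : rel T).
Variables (v : nat -> {set T}) (r : nat) (a b c : 'I_k).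
Hypothesis typed : forall D, Gvertex le n D -> exists i, sub_iso le D (P i).
Hypothesis vV : forall j, j <= r -> Gvertex le n (v j).
Hypothesis vA : forall j, j < r -> Gadj (v j) (v j.+1).
Hypothesis v_inj : forall i j, i <= r -> j <= r -> v i = v j -> i = j.
Hypothesis abc : [/\ a != b, b != c & a != c].
Hypothesis va : sub_iso le (v 0) (P a).
Hypothesis vb : forall j, 0 < j < r -> sub_iso le (v j) (P b).
Hypothesis vc : sub_iso le (v r) (P c).
Hypothesis minimal : forall w L, special_walk le P w L -> r <= L.
Hypothesis r_ge3 : 3 <= r.

(* A copy of P_1 would give the shorter special path D, v (t+1), ..., v r, and
   a copy of any other P_j the shorter special path v 0, ..., v t, D. *)
Lemma common_neighbour_type D t :
  Gvertex le n D -> 0 < t -> t.+2 <= r -> Gadj (v t) D -> Gadj D (v t.+1) ->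
  sub_iso le D (P b).
Proof.
move=> DV gt0t ltr vD Dv; have [x Dx] := typed DV.
have [neq_ab neq_bc neq_ac] := abc.
case: (eqVneq x b) => [<- // | neq_xb]; exfalso.
case: (eqVneq x a) => [exa | neq_xa].
  suff /minimal : special_walk le P (fun s => if s == 0 then D else v (s + t)) (r - t).
    by lia.
  split.
  - by case=> [|j] lej //=; apply: vV; lia.
  - by case=> [|j] ltj /=; rewrite ?add1n // !addSn; apply: vA; lia.
  - by lia.
  - exists a, b, c; split=> //=; first by rewrite -exa.
      by case=> [|j] //= rangej; apply: vb; lia.
    by rewrite ifN ?subnK //; lia.
suff /minimal : special_walk le P (fun s => if s <= t then v s else D) t.+1 by lia.
split.
- by move=> j lej /=; case: ifP => _ //; apply: vV; lia.
- move=> j ltj /=; rewrite -ltnS ltj.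
  case: ltnP => [ltjt | lejt]; first by apply: vA; lia.
  by have -> : j = t by lia.
- by lia.
- exists a, b, x; split=> //=.
  + by split=> //; rewrite eq_sym.
  + by move=> j /andP[gt0j lej]; rewrite -ltnS lej; apply: vb; lia.
  + by rewrite ltnn.
Qed.

Lemma no_bypass i m W : i < m < r -> ~ bypass le n v W i m.
Proof.
case/andP=> ltim ltmr [Wm WV vW WW vWv].
have Wb t : i < t < m -> sub_iso le (W t) (P b).
  move=> ranget; have [vWt Wvt] := vWv t ranget.
  by apply: common_neighbour_type vWt Wvt; [apply: WV | |]; lia.
pose w s := if s <= i then v s else if s <= m then W s else v s.+1.
suff /minimal : special_walk le P w r.-1 by lia.
split.
- move=> j lej; rewrite /w; case: leqP => [leji | ltij]; first by apply: vV; lia.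
  by case: leqP => [lejm | ltmj]; [apply: WV | apply: vV]; lia.
- move=> j ltj; rewrite /w; case: (ltngtP j i) => [ltji | ltij | ->].
  + by apply: vA; lia.
  + case: (ltngtP j m) => [ltjm | ltmj | ejm]; first by apply: WW; lia.
      by apply: vA; lia.
    by rewrite ejm Wm; apply: vA; lia.
  + by rewrite ltim.
- by lia.
- exists a, b, c; split=> //.
  + move=> j /andP[gt0j ltj]; rewrite /w; case: leqP => [leji | ltij].
      by apply: vb; lia.
    case: (ltngtP j m) => [ltjm | ltmj | ejm]; first by apply: Wb; lia.
      by apply: vb; lia.
    by rewrite ejm Wm; apply: vb; lia.
  + rewrite /w ifN; last by lia.
    case: leqP => [lerm | ltmr']; last by rewrite prednK //; lia.
    have -> : r.-1 = m by lia.
    by rewrite Wm (_ : m.+1 = r) //; lia.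
Qed.

Lemma no_cancelling p q u : p < q < r -> ~~ cancelling v p q u.
Proof.
have [N] := ubnP (q - p); elim: N => // N IHN in p q u *.
rewrite ltnS => gap /andP[ltpq ltqr]; apply/negP=> canc.
have leqnT : n <= #|T| by have [_ <-] := vV (leq0n r); apply: max_card.
have v_i_neq_v_i2 : v p != v p.+2.
  apply/eqP=> vpp; have : p = p.+2 by apply: v_inj vpp; lia.
  by lia.
have [W] : exists W, bypass le n v W p q.
  apply: (cancelling_bypass leqnT _ _ ltpq canc _ v_i_neq_v_i2).
  - by move=> t letq; apply: vV; lia.
  - by move=> t letq; apply: vA; lia.
  - by move=> p' q' u' lep' rangeq' gap'; apply: IHN; lia.
by apply: no_bypass; rewrite ltpq.
Qed.

Lemma membership_changes_once s t t' u :
  s <= t -> t <= t' -> t' <= r ->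
  (u \in v s) != (u \in v t) -> (u \in v t') = (u \in v t).
Proof.
move=> lest lett' let'r; case us: (u \in v s); case ut: (u \in v t) => //= _.
  apply/negP=> ut'.
  have [p /andP[lesp ltpt] lp] := leaves_between lest us (negbT ut).
  have [q /andP[letq ltqt'] eq] := enters_between lett' (negbT ut) ut'.
  have /negP[] : ~~ cancelling v p q u by apply: no_cancelling; lia.
  by rewrite /cancelling lp eq orbT.
apply/negPn/negP=> ut'.
have [p /andP[lesp ltpt] ep] := enters_between lest (negbT us) ut.
have [q /andP[letq ltqt'] lq] := leaves_between lett' ut ut'.
have /negP[] : ~~ cancelling v p q u by apply: no_cancelling; lia.
by rewrite /cancelling ep lq.
Qed.

Lemma card_setD_v0 t : t <= r -> #|v 0 :\: v t| = t.
Proof.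
elim: t => [|t IHt] letr; first by rewrite setDv cards0.
have [x lx] := Gadj_leaves (vA letr); have [xt xt1] := andP lx.
have x0 : x \in v 0.
  apply/negPn/negP=> x0.
  have := @membership_changes_once 0 t t.+1 x (leq0n t) (leqnSn t) letr.
  by rewrite (negbTE x0) xt (negbTE xt1) => /(_ isT).
have -> : v 0 :\: v t.+1 = x |: (v 0 :\: v t).
  apply/setP=> u; rewrite !inE; case: (eqVneq u x) => [-> | neq_ux] /=.
    by rewrite x0 xt1.
  case u0 : (u \in v 0); rewrite ?andbF // !andbT.
  case ut : (u \in v t) => /=.
    apply/negbTE/negP=> ut1; move/eqP: neq_ux; apply.
    by apply: leaves_uniq (vA letr) _ lx; rewrite /leaves ut ut1.
  have := @membership_changes_once 0 t t.+1 u (leq0n t) (leqnSn t) letr.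
  by rewrite u0 ut => ->.
by rewrite cardsU1 IHt ?(ltnW letr) // !inE xt.
Qed.

Lemma card_setD_vr_v0 : #|v r :\: v 0| = r.
Proof.
have [[_ card0] [_ cardr]] := (vV (leq0n r), vV (leqnn r)).
by rewrite cardsD setIC cardr -card0 -cardsD card_setD_v0.
Qed.

Lemma bigcup_path : \bigcup_(j < r.+1) v j = v 0 :|: v r.
Proof.
apply/eqP; rewrite eqEsubset; apply/andP; split.
  apply/bigcupsP=> j _; apply/subsetP=> u uj; rewrite inE; apply/norP=> -[u0 ur].
  have lejr : j <= r by rewrite -ltnS ltn_ord.
  have := @membership_changes_once 0 j r u (leq0n j) lejr (leqnn r).
  by rewrite (negbTE u0) uj (negbTE ur) => /(_ isT).
apply/subsetP=> u; rewrite inE => /orP[u0 | ur]; apply/bigcupP.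
  by exists ord0.
by exists ord_max.
Qed.

Lemma minimal_special_path_shape :
  [/\ \bigcup_(j < r.+1) v j = v 0 :|: v r,
      #|v 0 :\: v r| = r & #|v r :\: v 0| = r].
Proof. by rewrite bigcup_path card_setD_v0 ?card_setD_vr_v0. Qed.

End MinimalSpecialPath.

Theorem mainTheorem13 (n k : nat) (P : 'I_k -> rel 'I_n)
    (T : finType) (le : rel T) (v : nat -> {set T}) (r : nat) :
  3 <= k ->
  Gamma_family P ->
  witness le P ->
  special_path le P v r ->
  (forall (w : nat -> {set T}) (r' : nat), special_path le P w r' -> r <= r') ->
  3 <= r ->
  \bigcup_(j < r.+1) v j = v 0 :|: v r /\
  r - 1 = #|v 0 :\: (v 0 :&: v r)| - 1 /\
  r - 1 = #|v r :\: (v 0 :&: v r)| - 1.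
Proof.
move=> _ HG [_ [typed _]] [[vV vA v_inj] [_ [a [b [c [abc va vb vc]]]]]].
move=> minimal r_ge3.
have min_walk w L : special_walk le P w L -> r <= L.
  by case/(special_walk_path HG)=> L' leL' [w' /minimal/leq_trans]; apply.
have [-> card0 cardr] :=
  minimal_special_path_shape typed vV vA v_inj abc va vb vc min_walk r_ge3.
have setD_capr (X Y : {set T}) : X :\: (X :&: Y) = X :\: Y.
  by rewrite setDIr setDv set0U.
by rewrite setD_capr setIC setD_capr card0 cardr.
Qed.
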